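(* Let $G$ be a topological group and let $G^*=(G^*,\mathcal T)$ be the associated topological group of step functions $[0,1)\to G$ (defined in the context), with $G$ regarded as a subgroup of $G^*$ via constant functions. Then (a) $G$ is closed in $G^*=(G^*,\mathcal T)$; (b) $G^*$ is arcwise connected; and (c) $G^*\in\mathrm{SSGP}$.
   Context: All topological groups are assumed Hausdorff (equivalently, Tychonoff). Definition of $G^*$: for a Hausdorff topological group $G$, $G^*$ is, algebraically, the group of step functions $f:[0,1)\to G$ with finitely many steps, each of the form $[a,b)$ with $0\le a<b\le 1$, under pointwise multiplication in $G$. The topology $\mathcal T$ on $G^*$ is the one generated by (basic) neighborhoods of the identity $1_{G^*}$ of the form $N(U,\epsilon):=\{f\in G^*:\lambda(\{x\in[0,1): f(x)\notin U\})<\epsilon\}$, where $\epsilon>0$, $U$ is a neighborhood of $1_G$ in $G$, and $\lambda$ is Lebesgue measure on $[0,1)$. The group $G$ is identified with a topological subgroup of $G^*$ by associating to $x\in G$ the constant function $x^*$ with value $x$. A topological group $G$ has the small subgroup generating property ($G\in\mathrm{SSGP}$) if for every neighborhood $U$ of $1_G$ there is a family $\mathcal H$ of subgroups of $G$, each contained in $U$, such that the subgroup $\langle\bigcup\mathcal H\rangle$ generated by $\bigcup\mathcal H$ is dense in $G$. *)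

(* Defs.v *)
From HB Require Import structures.
From mathcomp Require Import all_boot all_order all_algebra.
From mathcomp Require Import all_classical all_reals all_analysis.

Set Implicit Arguments.
Unset Strict Implicit.
Unset Printing Implicit Defensive.

Import Order.TTheory GRing.Theory Num.Theory.
Import numFieldNormedType.Exports.

Local Open Scope classical_set_scope.
Local Open Scope ring_scope.

HB.structure Definition PreTopologicalGroup := {G of Topological G & Group G}.

HB.mixin Record PreTopologicalGroup_isTopologicalGroup G
    of PreTopologicalGroup G := {
  mulg_continuous : continuous (fun x : G * G => (x.1 * x.2)%g) ;
  invg_continuous : continuous (fun x : G => x^-1%g)
}.

#[short(type="topologicalGroupType")]
HB.structure Definition TopologicalGroup :=
  {G of PreTopologicalGroup G & PreTopologicalGroup_isTopologicalGroup G}.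

Definition is_subgroup (G : groupType) (H : set G) : Prop :=
  [/\ H 1%g,
      (forall x y, H x -> H y -> H (x * y)%g)
    & (forall x, H x -> H x^-1%g)].

Definition generated_subgroup (G : groupType) (A : set G) : set G :=
  smallest (@is_subgroup G) A.

Definition SSGP (G : topologicalGroupType) : Prop :=
  forall U : set G, nbhs 1%g U ->
  exists HH : set (set G),
    (forall H, HH H -> is_subgroup H /\ H `<=` U) /\
    dense (generated_subgroup (\bigcup_(H in HH) H)).

(* An arc is a homeomorphic image of the closed unit interval: [gamma] is a
   homeomorphism of [0, 1] onto its image, with inverse [delta]. *)
Definition arcwise_connected (R : realType) (T : topologicalType) : Prop :=
  forall x y : T, x <> y ->
  exists (gamma : R -> T) (delta : T -> R),
    [/\ {within `[0, 1], continuous gamma},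
        {within gamma @` `[0, 1], continuous delta},
        {in `[0, 1], cancel gamma delta},
        gamma 0 = x & gamma 1 = y].

Definition ico01 (R : realType) : Type := {x : R | 0 <= x < 1}.

(* [0 :: s] lists the endpoints 0 = t_0 < t_1 < ... < t_n = 1 of the steps
   [t_k, t_k+1[. *)
Definition is_step (R : realType) (T : Type) (f : ico01 R -> T) : Prop :=
  exists2 s : seq R, itv_partition 0 1 s &
    forall k, (k < size s)%N -> forall x y : ico01 R,
      nth 0 (0 :: s) k <= val x < nth 0 (0 :: s) k.+1 ->
      nth 0 (0 :: s) k <= val y < nth 0 (0 :: s) k.+1 ->
      f x = f y.

Record stepfun (R : realType) (T : Type) := StepFun {
  stepfun_val :> ico01 R -> T ;
  stepfunP : is_step stepfun_val
}.

HB.instance Definition _ (R : realType) (T : Type) := gen_eqMixin (stepfun R T).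
HB.instance Definition _ (R : realType) (T : Type) :=
  gen_choiceMixin (stepfun R T).

Section step_theory.
Context {R : realType}.
Local Notation I := (ico01 R).

Lemma partition_cover (a : R) (s : seq R) (b x : R) :
  itv_partition a b s -> a <= x < b ->
  exists2 k, (k < size s)%N & nth 0 (a :: s) k <= x < nth 0 (a :: s) k.+1.
Proof.
elim: s a => [|c s IH] a.
  by move=> /itv_partition_nil -> /andP[h1 h2]; move: (le_lt_trans h1 h2); rewrite ltxx.
move=> ps /andP[ax xb].
have [xc|cx] := ltP x c; first by exists 0%N => //=; rewrite ax.
have [|k ks h] := IH c (itv_partition_cons ps); first by rewrite cx.
by exists k.+1.
Qed.

(* An equivalent form of [is_step] that does not require the cut points to be
   sorted. *)
Lemma is_stepP (T : Type) (f : I -> T) :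
  is_step f <->
  exists s : seq R, forall x y : I,
    (forall c, c \in s -> (c <= val x) = (c <= val y)) -> f x = f y.
Proof.
split.
  move=> [s ps fs]; exists (0 :: s) => x y xy.
  have [k ks hx] := partition_cover ps (valP x).
  apply: (fs _ ks x y hx).
  have m1 : nth 0 (0 :: s) k \in 0 :: s by apply: mem_nth; rewrite /= ltnW.
  have m2 : nth 0 (0 :: s) k.+1 \in 0 :: s by apply: mem_nth.
  by move: hx; rewrite !ltNge (xy _ m1) (xy _ m2).
move=> [s fs].
pose s0 := sort <=%R (undup [seq c <- s | 0 < c < 1]).
have s0P c : c \in s0 = [&& c \in s, 0 < c & c < 1].
  by rewrite mem_sort mem_undup mem_filter andbC.
have s0sort : sorted <%R s0.
  by rewrite lt_sorted_uniq_le sort_uniq undup_uniq sort_le_sorted.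
have s0path : path <%R 0 s0.
  rewrite lt_path_sortedE s0sort andbT.
  by apply/allP => c; rewrite s0P => /and3P[].
exists (rcons s0 1).
  split; last by rewrite last_rcons.
  rewrite rcons_path s0path /=.
  have := mem_last 0 s0; rewrite inE => /predU1P[->//|].
  by rewrite s0P => /and3P[].
move=> k ks x y /andP[kx xk] /andP[ky yk]; apply: fs => c cs.
have [c0|c0] := leP c 0.
  by rewrite !(le_trans c0) //; [case/andP: (valP y)|case/andP: (valP x)].
have [c1|c1] := leP 1 c.
  have lt1 (z : I) : val z < c.
    by apply: lt_le_trans c1; case/andP: (valP z).
  by rewrite !leNgt !lt1.
have cin : c \in 0 :: rcons s0 1 by rewrite inE mem_rcons inE s0P cs c0 c1 !orbT.
have tsort : sorted <%R (0 :: rcons s0 1).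
  rewrite /= rcons_path s0path /=.
  have := mem_last 0 s0; rewrite inE => /predU1P[->//|].
  by rewrite s0P => /and3P[].
set t := 0 :: rcons s0 1 in cin tsort kx xk ky yk.
have tle i j : (i <= j)%N -> (j < size t)%N -> nth 0 t i <= nth 0 t j.
  move=> ij jt; apply: (sorted_leq_nth le_trans lexx) => //.
  - by move: tsort; rewrite lt_sorted_uniq_le => /andP[].
  - by rewrite inE (leq_ltn_trans ij).
have it : (index c t < size t)%N by rewrite index_mem.
have ct : nth 0 t (index c t) = c by rewrite nth_index.
have [ik|ki] := leqP (index c t) k.
  have ck : c <= nth 0 t k by rewrite -ct; apply: tle => //; rewrite /t/= ltnW.
  by rewrite !(le_trans ck).
have ck : nth 0 t k.+1 <= c by rewrite -ct; apply: tle.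
by rewrite !leNgt !(lt_le_trans _ ck).
Qed.

Lemma is_step_cst (T : Type) (c : T) : is_step (fun _ : I => c).
Proof. by apply/is_stepP; exists [::]. Qed.

Lemma is_step_map (T U : Type) (h : T -> U) (f : I -> T) :
  is_step f -> is_step (fun x => h (f x)).
Proof.
by move=> /is_stepP[s fs]; apply/is_stepP; exists s => x y /fs ->.
Qed.

Lemma is_step_pair (T U : Type) (f : I -> T) (g : I -> U) :
  is_step f -> is_step g -> is_step (fun x => (f x, g x)).
Proof.
move=> /is_stepP[s fs] /is_stepP[t gt]; apply/is_stepP; exists (s ++ t) => x y xy.
by congr pair; [apply: fs => c cs|apply: gt => c ct]; apply: xy;
  rewrite mem_cat ?cs ?ct ?orbT.
Qed.

Lemma stepfun_ext (T : Type) (f g : stepfun R T) :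
  (forall x, f x = g x) -> f = g.
Proof.
move: f g => [f fs] [g gs] /= /funext fg; move: fs gs; rewrite fg => fs gs.
by congr StepFun; exact: Prop_irrelevance.
Qed.

Definition ico01_0 : I := exist (fun x : R => 0 <= x < 1) 0
  (introT andP (conj (lexx 0) (@ltr01 R))).

Lemma is_step_finite_range (T : Type) (f : I -> T) : is_step f ->
  finite_set (range f).
Proof.
move=> [s ps fs].
pose cell k (x : I) := nth 0 (0 :: s) k <= val x < nth 0 (0 :: s) k.+1.
pose h k : T := match pselect (exists x : I, cell k x) with
  | left e => f (projT1 (cid e)) | right _ => f ico01_0 end.
apply: (@sub_finite_set _ _ (h @` `I_(size s))); last exact: finite_image.
move=> _ [x _ <-]; have [k ks hx] := partition_cover ps (valP x).
exists k => //; rewrite /h; case: pselect => [e|[]]; last by exists x.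
by apply: (fs _ ks) => //; exact: (projT2 (cid e)).
Qed.

Lemma measurable_step (T : Type) (f : I -> T) (B : set T) : is_step f ->
  measurable ((val @` (f @^-1` B)) : set R).
Proof.
move=> [s ps fs].
pose cell k (x : R) := nth 0 (0 :: s) k <= x < nth 0 (0 :: s) k.+1.
have -> : val @` (f @^-1` B) = \bigcup_(k in `I_(size s))
    (if `[< exists2 x : I, cell k (val x) & B (f x) >]
     then `[nth 0 (0 :: s) k, nth 0 (0 :: s) k.+1[%classic else set0) :> set R.
  apply/seteqP; split => [_ [x /= Bx <-]|y [k /= ks]].
    have [k ks hx] := partition_cover ps (valP x).
    exists k => //; case: asboolP => [_|[]]; last by exists x.
    by rewrite /= in_itv.
  case: asboolP => // -[x hx Bx]; rewrite /= in_itv /= => hy.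
  have y01 : 0 <= y < 1.
    case/andP: hy => h1 h2; apply/andP; split.
      by apply: le_trans h1; have := itv_partition_nth_ge (ltnW ks) ps;
        rewrite (set_nth_default 0)//= ltnW.
    by apply: lt_le_trans h2 _; have := itv_partition_nth_le (ks : (k.+1 < (size s).+1)%N) ps;
      rewrite (set_nth_default 0).
  exists (exist _ y y01 : I) => //=.
  by rewrite (fs _ ks (exist _ y y01) x).
apply: bigcup_measurable => k _; case: ifP => _ //.
Qed.

End step_theory.

Section stepfun_group.
Context {R : realType} {G : groupType}.

Definition step_one : stepfun R G := StepFun (is_step_cst 1%g).

Definition step_inv (f : stepfun R G) : stepfun R G :=
  StepFun (is_step_map (fun u => u^-1)%g (stepfunP f)).

Definition step_mul (f g : stepfun R G) : stepfun R G :=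
  StepFun (is_step_map (fun u : G * G => u.1 * u.2)%g
    (is_step_pair (stepfunP f) (stepfunP g))).

Lemma step_mulA : associative step_mul.
Proof. by move=> f g h; apply: stepfun_ext => x /=; rewrite mulgA. Qed.

Lemma step_mul1 : left_id step_one step_mul.
Proof. by move=> f; apply: stepfun_ext => x /=; rewrite mul1g. Qed.

Lemma step_mulr1 : right_id step_one step_mul.
Proof. by move=> f; apply: stepfun_ext => x /=; rewrite mulg1. Qed.

Lemma step_mulV : left_inverse step_one step_inv step_mul.
Proof. by move=> f; apply: stepfun_ext => x /=; rewrite mulVg. Qed.

Lemma step_mulrV : right_inverse step_one step_inv step_mul.
Proof. by move=> f; apply: stepfun_ext => x /=; rewrite mulgV. Qed.

HB.instance Definition _ := isGroup.Build (stepfun R G)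
  step_mulA step_mul1 step_mulr1 step_mulV step_mulrV.

Lemma step_mulE (f g : stepfun R G) x : (f * g)%g x = (f x * g x)%g.
Proof. by []. Qed.

Lemma step_invE (f : stepfun R G) x : (f^-1)%g x = (f x)^-1%g.
Proof. by []. Qed.

Lemma step_oneE x : (1 : stepfun R G)%g x = 1%g.
Proof. by []. Qed.

End stepfun_group.

Section stepfun_topology.
Context {R : realType} {G : topologicalGroupType}.
Local Notation GS := (stepfun R G).
Local Notation mu := (@lebesgue_measure R).

(* N(U, e); as [val] embeds [0, 1[ into [R], this is Lebesgue measure on
   [0, 1[. The sets involved are measurable, see [measurable_step]. *)
Definition step_nbhd (U : set G) (e : R) : set GS :=
  [set f | (mu (val @` [set x | ~ U (f x)]) < e%:E)%E].

Definition step_nbhs (f : GS) : set_system GS :=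
  [set A | exists (U : set G) (e : R), [/\ nbhs 1%g U, 0 < e &
    forall g, step_nbhd U e g -> A (f * g)%g]].

HB.instance Definition _ := hasNbhs.Build GS step_nbhs.

Lemma step_nbhd1 U e : nbhs 1%g U -> 0 < e -> step_nbhd U e 1%g.
Proof.
move=> U1 e0; rewrite /step_nbhd /=.
rewrite [X in mu X](_ : _ = set0) ?measure0 ?lte_fin//.
by apply/seteqP; split => // y [x nU _]; apply: nU; exact: nbhs_singleton U1.
Qed.

Lemma step_nbhd2 (U V W : set G) (e : R) (f g h : GS) :
  (forall x, V (g x) -> W (h x) -> U (f x)) ->
  step_nbhd V (e / 2) g -> step_nbhd W (e / 2) h -> step_nbhd U e f.
Proof.
rewrite /step_nbhd /= => VWU gV hW.
have mS (B : set G) (k : GS) : measurable (val @` [set x | ~ B (k x)] : set R).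
  exact: (measurable_step (~` B) (stepfunP k)).
apply: (@le_lt_trans _ _ (mu (val @` [set x | ~ V (g x)] `|`
                              val @` [set x | ~ W (h x)]))%E).
  apply: le_measure; rewrite ?inE; [exact: mS|by apply: measurableU; exact: mS|].
  move=> _ [x /= Ux <-].
  have [Vx|Vx] := pselect (V (g x)); last by left; exists x.
  by right; exists x => // Wx; apply: Ux; exact: VWU.
apply: (le_lt_trans (measureU2 _ _ _)); [exact: mS|exact: mS|].
by rewrite [in ltRHS](splitr e) EFinD lteD.
Qed.

Lemma step_nbhd_sub (U V : set G) (d e : R) (f g : GS) : d <= e ->
  (forall x, V (g x) -> U (f x)) -> step_nbhd V d g -> step_nbhd U e f.
Proof.
rewrite /step_nbhd /= => de VU gV.
have mS (B : set G) (k : GS) : measurable (val @` [set x | ~ B (k x)] : set R).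
  exact: (measurable_step (~` B) (stepfunP k)).
apply: (@lt_le_trans _ _ d%:E%E); last by rewrite lee_fin.
apply: le_lt_trans gV; apply: le_measure; rewrite ?inE; [exact: mS|exact: mS|].
by move=> _ [x /= Ux <-]; exists x => // /VU.
Qed.

Lemma mulg_nbhs1 (U : set G) : nbhs 1%g U ->
  exists2 V, nbhs 1%g V & forall a b, V a -> V b -> U (a * b)%g.
Proof.
move=> U1; have := @mulg_continuous G (1%g, 1%g) U.
rewrite /= mulg1 => /(_ U1) [[A B] /= [A1 B1] AB].
exists (A `&` B); first exact: filterI.
by move=> a b [aA _] [_ bB]; apply: (AB (a, b)).
Qed.

Lemma invg_nbhs1 (U : set G) : nbhs 1%g U -> nbhs 1%g [set a | U a^-1%g].
Proof. by move=> U1; have := @invg_continuous G 1%g U; rewrite invg1; apply. Qed.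

Lemma conjg_nbhs1 (U : set G) (c : G) : nbhs 1%g U ->
  nbhs 1%g [set a | U (c^-1 * a * c)%g].
Proof.
move=> U1.
have cvr : (fun a : G => (c^-1 * a)%g) @ (1%g : G) --> (c^-1 * 1)%g.
  apply: (@cvg_comp _ _ _ (fun a : G => (c^-1%g, a)) (fun p => p.1 * p.2)%g).
    by apply: (@cvg_pair _ _ _ _ (nbhs c^-1%g) (nbhs 1%g)); [exact: cvg_cst|exact: cvg_id].
  exact: (@mulg_continuous G (c^-1, 1)%g).
have cvc : (fun a : G => (c^-1 * a * c)%g) @ (1%g : G) --> (c^-1 * 1 * c)%g.
  apply: (@cvg_comp _ _ _ (fun a : G => ((c^-1 * a)%g, c)) (fun p => p.1 * p.2)%g).
    by apply: (@cvg_pair _ _ _ _ (nbhs (c^-1 * 1)%g) (nbhs c)); [exact: cvr|exact: cvg_cst].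
  exact: (@mulg_continuous G (c^-1 * 1, c)%g).
by have := cvc U; rewrite mulg1 mulVg; apply.
Qed.

Lemma step_nbhd_conj (U : set G) (g : GS) : nbhs 1%g U ->
  exists2 V, nbhs 1%g V & forall e f, step_nbhd V e f ->
    step_nbhd U e (g^-1 * f * g)%g.
Proof.
move=> U1.
pose V := \bigcap_(c in range g) [set a : G | U (c^-1 * a * c)%g].
exists V.
  have /finite_fsetP[X gX] := is_step_finite_range (stepfunP g).
  by rewrite /V gX; apply: filter_bigI => c _; exact: conjg_nbhs1.
move=> e f; apply: step_nbhd_sub => // x Vx.
by rewrite !step_mulE step_invE; apply: Vx; exists x.
Qed.

Lemma step_nbhs_filter (f : GS) : ProperFilter (nbhs f).
Proof.
apply: Build_ProperFilter_ex.
  move=> A [U [e [U1 e0 UA]]]; exists (f * 1)%g; exact/UA/step_nbhd1.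
split.
- by exists setT, 1; split => //; exact: filterT.
- move=> A B [U [d [U1 d0 UA]]] [V [e [V1 e0 VB]]].
  exists (U `&` V), (Num.min d e); split; first exact: filterI.
    by rewrite lt_min d0.
  move=> g gUV; split; [apply: UA|apply: VB]; apply: step_nbhd_sub gUV.
  + by rewrite ge_min lexx.
  + by move=> x [].
  + by rewrite ge_min lexx orbT.
  + by move=> x [].
- move=> A B AB [U [e [U1 e0 UA]]]; exists U, e; split => // g /UA; exact: AB.
Qed.

Lemma step_nbhs_singleton (f : GS) (A : set GS) : nbhs f A -> A f.
Proof. by move=> [U [e [U1 e0 UA]]]; rewrite -[f]mulg1; exact/UA/step_nbhd1. Qed.

Lemma step_nbhs_nbhs (f : GS) (A : set GS) : nbhs f A -> nbhs f (nbhs^~ A).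
Proof.
move=> [U [e [U1 e0 UA]]]; have [V V1 VU] := mulg_nbhs1 U1.
have e20 : 0 < e / 2 by rewrite divr_gt0.
exists V, (e / 2); split => // g gV; exists V, (e / 2); split => // h hV.
rewrite -mulgA; apply: UA; apply: (step_nbhd2 _ gV hV) => x.
by rewrite step_mulE; exact: VU.
Qed.

HB.instance Definition _ := Nbhs_isNbhsTopological.Build GS
  step_nbhs_filter step_nbhs_singleton step_nbhs_nbhs.

Lemma step_mulg_continuous : continuous (fun x : GS * GS => (x.1 * x.2)%g).
Proof.
move=> [f g] A [U [e [U1 e0 UA]]]; have [V V1 VU] := mulg_nbhs1 U1.
have [W W1 WV] := step_nbhd_conj g V1.
have e20 : 0 < e / 2 by rewrite divr_gt0.
exists ([set (f * k)%g | k in step_nbhd W (e / 2)],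
        [set (g * k)%g | k in step_nbhd V (e / 2)]) => /=.
  by split; [exists W, (e / 2)|exists V, (e / 2)]; split => // k kW; exists k.
move=> [_ _] [/= [h hW <-] [k kV <-]] /=.
rewrite (_ : f * h * (g * k) = f * g * ((g^-1 * h * g) * k))%g; last first.
  by rewrite !mulgA mulgK.
apply: UA; apply: (step_nbhd2 _ (WV _ _ hW) kV) => x.
by rewrite [X in _ -> _ -> U X]step_mulE; exact: VU.
Qed.

Lemma step_invg_continuous : continuous (fun x : GS => x^-1%g).
Proof.
move=> f A [U [e [U1 e0 UA]]].
have [W W1 WU] := step_nbhd_conj (f^-1)%g (invg_nbhs1 U1).
exists W, e; split => // h hW /=.
rewrite (_ : (f * h)^-1 = f^-1 * ((f^-1)^-1 * h * f^-1)^-1)%g; last first.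
  by rewrite !invgM !invgK !mulgA mulVg mul1g.
by apply: UA; apply: step_nbhd_sub (WU _ _ hW).
Qed.

HB.instance Definition _ := PreTopologicalGroup_isTopologicalGroup.Build GS
  step_mulg_continuous step_invg_continuous.

End stepfun_topology.

Definition cst_step (R : realType) (G : groupType) (x : G) : stepfun R G :=
  StepFun (is_step_cst x).

(* Main.v *)
(** (a) If a step function [f] takes two values [p <> q], each on a set of
    measure at least [e], then a constant [c] with [f^-1 * c] in [N(U, e)]
    satisfies both [p^-1 * c \in U] and [q^-1 * c \in U], so that
    [p^-1 * q \in U * U^-1]; this fails for [U] small since [G] is Hausdorff.

    (b) Given [f <> g], let [s_a] be the function equal to [g] on [[0, a[[ and
    to [f] on [[a, 1[[, and let [dist] be the measure of the set where two step
    functions differ. The path [a |-> s_a] may be stationary, so it is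
    reparametrized by [a |-> dist f s_a], which is continuous.
    The inverse of the resulting arc is [h |-> dist f h / dist f g].

    (c) The functions that are trivial off [[a, a + d[[ form a subgroup,
    contained in [N(U, e)] when [d < e]. Cutting [[0, 1[[ into pieces of length
    [d] shows that these subgroups generate the whole group. *)
Require Import Defs.
From mathcomp Require Import all_boot all_order all_algebra.
From mathcomp Require Import all_classical all_reals all_analysis.

Local Open Scope classical_set_scope.
Local Open Scope ring_scope.

Set Implicit Arguments.
Unset Strict Implicit.
Import Order.TTheory GRing.Theory Num.Theory.
Import numFieldNormedType.Exports.

(** * Positive measure of nonempty preimages *)

Section step_values.
Context {R : realType} {T : Type}.
Local Notation mu := (@lebesgue_measure R).
Implicit Types (f : stepfun R T) (B : set T).

Lemma stepfun_right_constant f (x : ico01 R) :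
  exists2 b : R, val x < b <= 1 &
    forall z : ico01 R, val x <= val z < b -> f z = f x.
Proof.
have [s ps fs] := stepfunP f.
have [k ks /andP[kx xk]] := partition_cover ps (valP x).
exists (nth 0 (0 :: s) k.+1).
  rewrite xk /=; have := itv_partition_nth_le (ks : (k.+1 < (size s).+1)%N) ps.
  by rewrite (set_nth_default 0).
move=> z /andP[xz zk]; apply: (fs _ ks); last by rewrite kx xk.
by rewrite zk (le_trans kx xz).
Qed.

(** Steps are half-open on the right, so the value at [x] persists on some [[x, b[] of positive
    length. *)
Lemma measure_step_lower_bound f B (x : ico01 R) : B (f x) ->
  exists2 e : R, 0 < e & (e%:E <= mu (val @` (f @^-1` B)))%E.
Proof.
move=> Bx; have [b /andP[xb b1] fb] := stepfun_right_constant f x.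
exists (b - val x); first by rewrite subr_gt0.
apply: (@le_trans _ _ (mu `[val x, b[%classic)).
  by rewrite lebesgue_measure_itv /= lte_fin xb -EFinB.
apply: le_measure; rewrite ?inE //; first exact: (measurable_step B (stepfunP f)).
move=> y; rewrite /= in_itv /= => /andP[xy yb].
have y01 : 0 <= y < 1.
  by rewrite (lt_le_trans yb b1) (le_trans _ xy)//; case/andP: (valP x).
by exists (exist _ y y01 : ico01 R) => //=; rewrite fb //= xy.
Qed.

End step_values.

(** * Splices and the measure of the set where two functions differ *)

Section step_distance.
Context {R : realType} {T : Type}.
Local Notation mu := (@lebesgue_measure R).
Implicit Types (f g : stepfun R T) (a b : R).

Lemma is_step_splice a f g :
  is_step (fun x : ico01 R => if val x < a then f x else g x).
Proof.
have /is_stepP[s fs] := stepfunP f; have /is_stepP[t gt] := stepfunP g.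
apply/is_stepP; exists (a :: s ++ t) => x y xy.
rewrite !ltNge (xy a) ?mem_head //; case: ifP => _.
  by apply: fs => c cs; apply: xy; rewrite inE mem_cat cs orbT.
by apply: gt => c ct; apply: xy; rewrite inE mem_cat ct !orbT.
Qed.

Definition splice a f g : stepfun R T := StepFun (is_step_splice a f g).

Lemma splice0 f g : splice 0 f g = g.
Proof.
apply: stepfun_ext => x /=.
by have /andP[x0 _] := valP x; rewrite ltNge x0.
Qed.

Lemma splice_ge1 a f g : 1 <= a -> splice a f g = f.
Proof.
move=> a1; apply: stepfun_ext => x /=.
by have /andP[_ x1] := valP x; rewrite (lt_le_trans x1 a1).
Qed.

Definition step_diff f g : set R := val @` [set x : ico01 R | f x <> g x].

Lemma measurable_step_diff f g : measurable (step_diff f g).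
Proof.
exact: (measurable_step [set p | p.1 <> p.2]
  (is_step_pair (stepfunP f) (stepfunP g))).
Qed.

(** A Hamming-type distance, blind to any topology on [T]. [fine] loses nothing, as [step_diff] lies
    in [[0, 1[]. *)
Definition step_dist f g : R := fine (mu (step_diff f g)).

Lemma step_distE f g : mu (step_diff f g) = (step_dist f g)%:E.
Proof.
rewrite fineK // ge0_fin_numE ?measure_ge0 //.
apply: (@le_lt_trans _ _ (mu `[0%R, 1%R[%classic)).
  apply: le_measure; rewrite ?inE //; first exact: measurable_step_diff.
  by move=> _ [x _ <-]; rewrite /= in_itv; exact: (valP x).
by rewrite lebesgue_measure_itv /= lte01 -EFinB ltry.
Qed.

Lemma step_dist_ge0 f g : 0 <= step_dist f g.
Proof. by rewrite fine_ge0 ?measure_ge0. Qed.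

Lemma step_distC f g : step_dist f g = step_dist g f.
Proof.
by congr (fine (mu _)); apply/seteqP; split => _ [x /= fg <-];
  exists x => //; exact/nesym.
Qed.

(** A point where [f] and [g] differ yields a whole interval of such points, by the lower bound
    applied to the pair [(f, g)]. *)
Lemma step_dist0_eq f g : step_dist f g = 0 -> f = g.
Proof.
move=> fg0; apply: stepfun_ext => x; apply: contrapT => fgx.
pose p := StepFun (is_step_pair (stepfunP f) (stepfunP g)).
have [e e0] := measure_step_lower_bound (f := p) (B := [set q | q.1 <> q.2]) fgx.
by rewrite [X in (_ <= X)%E](step_distE f g) fg0 lee_fin leNgt e0.
Qed.

(** The two difference sets on the right lie to the left of [a] and in [[a, b[], so they are
    disjoint: splices run along a geodesic from [g]. *)
Lemma step_distD a b f g : a <= b ->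
  step_dist g (splice b f g) =
  step_dist g (splice a f g) + step_dist (splice a f g) (splice b f g).
Proof.
move=> ab; apply: EFin_inj; rewrite EFinD -!step_distE -measureU //;
  try exact: measurable_step_diff.
  congr (mu _); apply/seteqP; split => [_ [x /= xb <-]|_ [] [x /= + <-]].
  - have [xa|ax] := ltP (val x) a.
      left; exists x => //=; rewrite xa.
      by move: xb; rewrite (lt_le_trans xa ab).
    by right; exists x => //=; rewrite ltNge ax.
  - case: ltP => // xa gf; exists x => //=.
    by rewrite (lt_le_trans xa ab).
  - case: (ltP _ a) => [xa|ax]; first by rewrite (lt_le_trans xa ab).
    by move=> gf; exists x.
apply/seteqP; split => // _ [[x /= xa <-] [y /= + yx]].
move: yx => /val_inj ->; move: xa; case: ltP => // xa _.
by rewrite (lt_le_trans xa ab).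
Qed.

Lemma step_dist_splice a b f g :
  step_dist (splice a f g) (splice b f g) =
  `|step_dist g (splice b f g) - step_dist g (splice a f g)|.
Proof.
wlog ab : a b / a <= b => [H|].
  have [/H//|/ltW/H] := leP a b.
  by rewrite step_distC distrC.
by rewrite (step_distD _ _ ab) addrAC subrr add0r ger0_norm ?step_dist_ge0.
Qed.

Lemma step_dist_splice_le a b f g :
  step_dist (splice a f g) (splice b f g) <= `|b - a|.
Proof.
wlog ab : a b / a <= b => [H|].
  have [/H//|/ltW/H] := leP a b.
  by rewrite step_distC distrC.
rewrite ger0_norm ?subr_ge0 // -lee_fin -step_distE.
apply: (@le_trans _ _ (mu `[a, b[%classic)).
  apply: le_measure; rewrite ?inE //; first exact: measurable_step_diff.
  move=> _ [x /= xab <-]; rewrite /= in_itv /=; apply/andP.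
  split; [rewrite leNgt|rewrite ltNge]; apply/negP => xab'; apply: xab.
    by rewrite xab' (lt_le_trans xab' ab).
  by rewrite !ltNge xab' (le_trans ab xab').
by rewrite lebesgue_measure_itv /= lte_fin; case: ifP => [_|_]; rewrite ?lee_fin ?subr_ge0.
Qed.

Lemma step_dist_splice_continuous f g :
  continuous (fun a => step_dist g (splice a f g)).
Proof.
move=> a; apply/cvgrPdist_le => e e0.
apply: filterS (@cvgr_dist_le _ _ _ _ _ _ _ (@cvg_id _ (nbhs a)) _ e0) => b.
by rewrite -step_dist_splice; exact: le_trans (step_dist_splice_le _ _ _ _).
Qed.

Lemma step_dist_splice_surj f g t : 0 <= t <= 1 ->
  exists a, step_dist g (splice a f g) = t * step_dist g f.
Proof.
move=> /andP[t0 t1].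
have gf0 := step_dist_ge0 g f.
have [||a _ aE] := @IVT R (fun a => step_dist g (splice a f g)) 0 1
    (t * step_dist g f) ler01; last by exists a.
  by apply: continuous_subspaceT => a; exact: step_dist_splice_continuous.
have gg : step_dist g g = 0.
  rewrite /step_dist (_ : step_diff g g = set0) ?measure0 //.
  by apply/seteqP; split => // _ [x /= []].
rewrite splice0 splice_ge1 // gg (min_idPl _) // (max_idPr _) //.
by rewrite mulr_ge0 // ler_piMl.
Qed.

End step_distance.

(** * Closedness of the constants, and arcs between step functions *)

Section step_group.
Context {R : realType} {G : topologicalGroupType}.
Local Notation GS := (stepfun R G).
Local Notation mu := (@lebesgue_measure R).
Implicit Types (f g : GS) (U : set G) (A : set GS).

(** Where [f] and [g] agree, [f^-1 * g] is 1 and lies in [U]; hence the topology of [step_dist]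
    refines that of the group. *)
Lemma nbhs_step_dist f A : nbhs f A ->
  exists2 e : R, 0 < e & forall g, step_dist f g < e -> A g.
Proof.
move=> [U [e [U1 e0 UA]]]; exists e => // g fge.
have -> : g = (f * (f^-1 * g))%g by rewrite mulVKg.
apply: UA; rewrite /step_nbhd /=; apply: (@le_lt_trans _ _ (mu (step_diff f g))).
  apply: le_measure; rewrite ?inE; last 1 first.
  - move=> _ [x /= Ux <-]; exists x => //= fgx; apply: Ux.
    by rewrite fgx mulVg; exact: nbhs_singleton U1.
  - exact: (measurable_step (~` U) (stepfunP (f^-1 * g)%g)).
  - exact: measurable_step_diff.
by rewrite step_distE lte_fin.
Qed.

Lemma nbhs1_avoid_finite (X : set G) : hausdorff_space G -> finite_set X ->
  ~ X 1%g -> nbhs 1%g (~` X).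
Proof.
move=> hG finX X1; apply: open_nbhs_nbhs; split => //.
apply: closed_openC.
exact: (accessible_finite_set_closed.1 (hausdorff_accessible hG)).
Qed.

Lemma closed_range_cst_step : hausdorff_space G ->
  closed (range (@cst_step R G) : set GS).
Proof.
move=> hG f clf.
suff fcst x y : f x = f y.
  by exists (f ico01_0) => //; apply: stepfun_ext => x /=; exact: fcst.
apply: contrapT => fxy.
have [V V1 VP] : exists2 V, nbhs 1%g V &
    forall a b : G, V a -> V b -> (a * b)%g <> ((f x)^-1 * f y)%g.
  apply: (mulg_nbhs1 (U := ~` [set (f x)^-1 * f y]%g)).
  apply: (nbhs1_avoid_finite hG (finite_set1 _)).
  by move=> /= /esym/mulg1_eq; rewrite invgK.
(* Intersecting with the inverse lets the relation at [y] be inverted and multiplied with the one at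
   [x], which eliminates [c]. *)
pose U := V `&` [set a | V a^-1%g].
have U1 : nbhs 1%g U by apply: filterI => //; exact: invg_nbhs1.
have [d d0 dx] := measure_step_lower_bound (f := f) (B := [set f x]) (x := x) erefl.
have [e e0 ey] := measure_step_lower_bound (f := f) (B := [set f y]) (x := y) erefl.
have [_ [[c _ <-] [g gU cE]]] :
    range (@cst_step R G) `&` [set (f * g)%g | g in step_nbhd U (Num.min d e)]
    !=set0.
  apply: clf; exists U, (Num.min d e); split => //; first by rewrite lt_min d0.
  by move=> g gU; exists g.
(* Otherwise [g], which is constant on the level set of [f z], misses [U] on all of it, a set too
   large for [step_nbhd]. *)
have meet (z : ico01 R) : ((Num.min d e)%:E <=
    mu (val @` (f @^-1` [set f z])))%E -> U ((f z)^-1 * c)%g.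
  move=> zde; apply: contrapT => Uz.
  have := lt_le_trans gU zde; apply/negP; rewrite -leNgt.
  apply: le_measure; rewrite ?inE; last 1 first.
  - move=> _ [w /= fwz <-]; exists w => //=.
    have -> : g w = ((f w)^-1 * (f * g)%g w)%g by rewrite step_mulE mulKg.
    by rewrite cE fwz.
  - exact: (measurable_step [set f z] (stepfunP f)).
  - exact: (measurable_step (~` U) (stepfunP g)).
have [Vx _] : U ((f x)^-1 * c)%g.
  by apply: meet; apply: le_trans dx; rewrite lee_fin ge_min lexx.
have [_ Vy] : U ((f y)^-1 * c)%g.
  by apply: meet; apply: le_trans ey; rewrite lee_fin ge_min lexx orbT.
by apply: (VP _ _ Vx Vy); rewrite invgM invgK mulgA mulgK.
Qed.

(** By [gammaE] the path scales distances by [m]. This gives continuity of [gamma], [step_dist]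
    being finer than the group topology; on the path, whose values form a finite set, the two
    topologies agree, which gives continuity of the inverse. *)
Lemma arcwise_connected_stepfun : hausdorff_space G -> arcwise_connected R GS.
Proof.
move=> hG f g fg; pose m := step_dist f g.
have m0 : 0 < m.
  by rewrite lt_neqAle step_dist_ge0 andbT eq_sym; apply/eqP => /step_dist0_eq.
(* The cut [a t] may jump across intervals where [f] and [g] agree; only its distance from [f]
   matters. Outside [[0, 1]] the witness 0 is a dummy. *)
have /choice[a aP] : forall t : R, exists a : R, t \in `[0, 1] ->
    step_dist f (splice a g f) = t * m.
  move=> t; have [t01|] := boolP (t \in `[0, 1]); last by exists 0.
  have [|a aP] := @step_dist_splice_surj R G g f t; last by exists a.
  by move: t01; rewrite in_itv.
pose gamma (t : R) := splice (a t) g f.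
have gammaE (t u : R) : t \in `[0, 1] -> u \in `[0, 1] ->
    step_dist (gamma t) (gamma u) = `|u - t| * m.
  move=> t01 u01; rewrite step_dist_splice !aP // -mulrBl normrM.
  by rewrite (gtr0_norm m0).
have in0 : (0 : R) \in `[0, 1] by rewrite in_itv /= lexx ler01.
have in1 : (1 : R) \in `[0, 1] by rewrite in_itv /= lexx ler01.
exists gamma, (fun h => step_dist f h / m); split.
- apply/subspace_continuousP => t t01 A /nbhs_step_dist[e e0 eA].
  have em0 : 0 < e / m by rewrite divr_gt0.
  apply: filterS (@cvgr_dist_lt _ _ _ _ _ _ _ (@cvg_id _ (nbhs t)) _ em0).
  move=> u /= tu u01; apply: eA.
  by rewrite gammaE // -ltr_pdivlMr // distrC.
- apply/subspace_continuousP => _ [t t01 <-]; apply/cvgrPdist_lt => e e0.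
  (* [gamma t] and [gamma u] take their values in the finite set [Y], so
     their quotient avoids [X] exactly where they agree. *)
  pose Y := range f `|` range g.
  pose X := [set (p.1^-1 * p.2)%g | p in Y `*` Y] `\ 1%g.
  have finX : finite_set X.
    apply: finite_setD; apply: finite_image.
    by apply: finite_setX; rewrite finite_setU; split;
      exact: is_step_finite_range (stepfunP _).
  exists (~` X), (e * m); split.
  + by apply: nbhs1_avoid_finite => // -[_]; exact.
  + by rewrite mulr_gt0.
  move=> h hX [u u01 uE].
  rewrite -uE /from_subspace !aP // !mulfK ?gt_eqF // -(ltr_pM2r m0) distrC -gammaE //.
  rewrite -lte_fin -step_distE; apply: le_lt_trans hX.
  apply: le_measure; rewrite ?inE; last 1 first.
  + move=> _ [x /= tux <-]; exists x => //=; apply.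
    have -> : h x = ((gamma t x)^-1 * gamma u x)%g.
      by rewrite uE step_mulE mulKg.
    split; last by move=> /= /mulg1_eq; rewrite invgK.
    by exists (gamma t x, gamma u x) => //; split => /=; case: ifP => _;
      [right|left|right|left]; exists x.
  + exact: measurable_step_diff.
  + exact: (measurable_step (~` ~` X) (stepfunP h)).
- by move=> t t01; rewrite aP // mulfK ?gt_eqF.
- by apply/esym/step_dist0_eq; rewrite aP // mul0r.
(* Seen as the splice at 1, [g] lies on the path, at the same distance [m] from [f] as [gamma 1]. *)
- apply: step_dist0_eq; rewrite -[X in step_dist _ X](@splice_ge1 _ _ 1 g f) //.
  by rewrite step_dist_splice aP // splice_ge1 // mul1r subrr normr0.
Qed.

(** * Small subgroups of functions supported on short intervals *)

Definition supported_on (B : set R) : set GS :=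
  [set f | forall x : ico01 R, ~ B (val x) -> f x = 1%g].

Lemma is_subgroup_supported_on B : is_subgroup (supported_on B).
Proof.
split => [x|f g fB gB x Bx|f fB x Bx].
- by rewrite step_oneE.
- by rewrite step_mulE fB // gB // mul1g.
- by rewrite step_invE fB // invg1.
Qed.

Lemma supported_on_itv_step_nbhd (a d : R) (e : R) U : 0 < d -> d < e ->
  nbhs 1%g U -> supported_on `[a, a + d[ `<=` step_nbhd U e.
Proof.
move=> d0 de U1 f fa; rewrite /step_nbhd /=.
apply: (@le_lt_trans _ _ (mu `[a, a + d[%classic)).
  apply: le_measure; rewrite ?inE //.
    exact: (measurable_step (~` U) (stepfunP f)).
  move=> _ [x /= Ux <-]; apply: contrapT => xa; apply: Ux.
  by rewrite fa //; exact: nbhs_singleton U1.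
rewrite lebesgue_measure_itv /= lte_fin ltrDl d0 -EFinB lte_fin.
by rewrite addrAC subrr add0r.
Qed.

Lemma generated_supported_on (d : R) : 0 < d ->
  generated_subgroup (\bigcup_(H in range (fun a => supported_on `[a, a + d[)) H)
  = setT.
Proof.
move=> d0; apply/seteqP; split => // f _ K [[K1 KM _] HK].
have Kn n : K (splice (n%:R * d) f 1%g).
  elim: n => [|n IH]; first by rewrite mul0r splice0.
  set b := n.+1%:R * d.
  have bE : b = n%:R * d + d by rewrite /b -natr1 mulrDl mul1r.
  (* The second factor is [f] cut down to the next piece of length [d]. *)
  have -> : splice b f 1%g = (splice (n%:R * d) f 1 *
      splice (n%:R * d) 1 (splice b f 1))%g.
    apply: stepfun_ext => x; rewrite step_mulE /=.
    case: (ltP _ (n%:R * d)) => [xn|_]; last by rewrite mul1g.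
    by rewrite mulg1 (lt_trans xn) // bE ltrDl.
  apply: KM => //; apply: HK; exists (supported_on `[n%:R * d, n%:R * d + d[).
    by exists (n%:R * d).
  move=> x /= xn; case: ltP => // nx; rewrite bE; case: ltP => // xb.
  by exfalso; apply: xn; rewrite in_itv /= nx.
(* Once the pieces reach 1, the truncation of [f] is [f] itself. *)
have [n nd] : exists n : nat, 1 <= n%:R * d.
  exists (Num.truncn d^-1).+1.
  by rewrite -ler_pdivrMr // mul1r ltW // truncnS_gt.
by rewrite -(@splice_ge1 _ _ (n%:R * d) f 1%g).
Qed.

Lemma SSGP_stepfun : SSGP GS.
Proof.
move=> A [U [e [U1 e0 UA]]].
(* Half of [e] leaves room for the strict inequality in [step_nbhd]. *)
have d0 : 0 < e / 2 by rewrite divr_gt0.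
exists (range (fun a => supported_on `[a, a + e / 2[)); split.
  move=> _ [a _ <-]; split; first exact: is_subgroup_supported_on.
  move=> f fa; rewrite -[f]mul1g; apply: UA.
  apply: supported_on_itv_step_nbhd fa => //.
  by rewrite ltr_pdivrMr // ltr_pMr // ltr1n.
by rewrite generated_supported_on // => B [f Bf] _; exists f.
Qed.

End step_group.

Theorem theorem2p18 (R : realType) (G : topologicalGroupType)
    (hG : hausdorff_space G) :
  [/\ closed (range (@cst_step R G) : set (stepfun R G)),
      arcwise_connected R (stepfun R G)
    & SSGP (stepfun R G)].
Proof.
split; [exact: closed_range_cst_step|exact: arcwise_connected_stepfun|].
exact: SSGP_stepfun.
Qed.
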